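(* Let $(T_1,\dots,T_n)$ be a doubly $Q$-commuting tuple of contractions acting on a Hilbert space $\mathcal{H}$. Then there corresponds a decomposition of $\mathcal{H}$ into an orthogonal sum of $2^n$ joint reducing subspaces $\mathcal{H}_1,\dots,\mathcal{H}_{2^n}$ for $T_1,\dots,T_n$ and $Q$ such that the following hold. (1) $T_i|_{\mathcal{H}_j}$ is either a unitary or a c.n.u. contraction for $1\le i\le n$ and $1\le j\le 2^n$; (2) $\mathcal{H}_1$ is the largest closed joint reducing subspace of $\mathcal{H}$ on which each $T_j$ acts as a unitary; (3) $\mathcal{H}_{2^n}$ is the largest closed joint reducing subspace of $\mathcal{H}$ on which each $T_j$ is a c.n.u. contraction; (4) If $\Theta_n$ is the set of all functions $\theta:\{1,\dots,n\}\to\{A_u,A_{cnu}\}$, then for every $\theta\in\Theta_n$ there corresponds a unique subspace $\mathcal{H}_{t(\theta)}$ ($1\le t(\theta)\le 2^n$) such that the $k$-th component of $(T_1|_{\mathcal{H}_{t(\theta)}},\dots,T_n|_{\mathcal{H}_{t(\theta)}})$ is of the type $\theta(k)$ for $1\le k\le n$ and $\mathcal{H}_{t(\theta)}$ is the largest such joint reducing subspace for $T_1,\dots,T_n$ and $Q$.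
   Context: All operators are bounded linear maps on complex Hilbert spaces; a contraction is an operator of norm at most $1$. A tuple $(T_1,\dots,T_n)$ of operators on $\mathcal{H}$ is doubly $Q$-commuting if there is a commuting family $Q=\{Q_{ij}\in\mathcal{B}(\mathcal{H}): Q_{ij}=Q_{ji}^*,\ i\ne j\}$ of unitaries such that $T_iT_j=Q_{ij}T_jT_i$, $T_iT_j^*=Q_{ij}^*T_j^*T_i$ and $T_kQ_{ij}=Q_{ij}T_k$ for all $i\ne j$ and all $k$. A closed subspace is a joint reducing subspace for $T_1,\dots,T_n$ and $Q$ if it reduces every $T_i$ and every $Q_{ij}$. A contraction $T$ is completely non-unitary (c.n.u.) if there is no nonzero closed subspace that reduces $T$ and on which $T$ acts as a unitary. Type $A_u$ means unitary; type $A_{cnu}$ means c.n.u. contraction. Some of the subspaces may be $\{0\}$, and an operator on the zero space is allowed to be of either type. *)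

(* Defs.v *)
From HB Require Import structures.
From mathcomp Require Import all_boot all_order all_algebra.
From mathcomp Require Import complex sesquilinear.
From mathcomp Require Import all_classical all_reals all_analysis.

Set Implicit Arguments.
Unset Strict Implicit.
Unset Printing Implicit Defensive.

Import Order.TTheory GRing.Theory Num.Theory.
Import numFieldNormedType.Exports.

Local Open Scope classical_set_scope.
Local Open Scope ring_scope.
Local Open Scope complex_scope.

(* A complex Hilbert space is a complete normed space [H] over [R[i]] with an
   inner product [dot] (linear in its first argument) inducing its norm. *)
Definition hilbert_dot (R : realType) (H : completeNormedModType R[i])
    (dot : {dot H for Num.conj}) : Prop :=
  forall x : H, `|x| ^+ 2 = dot x x.

Definition closed_subspace (R : realType) (H : completeNormedModType R[i])
    (L : set H) : Prop :=
  [/\ closed L, L 0 & forall (a : R[i]) (x y : H), L x -> L y -> L (a *: x + y)].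

(* The norm of the restriction of [T] to [L]; the norm of [H] takes its values
   in [R[i]], hence the real part. *)
Definition opnorm_on (R : realType) (H : completeNormedModType R[i])
    (L : set H) (T : H -> H) : \bar R :=
  ereal_sup [set (complex.Re `|T x|)%:E | x in [set x | L x /\ `|x| <= 1]].

Definition bounded_operator (R : realType) (H : completeNormedModType R[i])
    (T : H -> H) : Prop := (opnorm_on setT T < +oo)%E.

Definition contraction_on (R : realType) (H : completeNormedModType R[i])
    (L : set H) (T : H -> H) : Prop := (opnorm_on L T <= 1)%E.

(* For a bounded linear [T], the vector selected here exists by the Riesz
   representation theorem, and is unique since [dot] is definite. *)
Definition adjoint (R : realType) (H : completeNormedModType R[i])
    (dot : {dot H for Num.conj}) (T : H -> H) (y : H) : H :=
  get [set z : H | forall x : H, dot (T x) y = dot x z].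

Definition reduces (R : realType) (H : completeNormedModType R[i])
    (dot : {dot H for Num.conj}) (L : set H) (T : H -> H) : Prop :=
  forall x : H, L x -> L (T x) /\ L (adjoint dot T x).

(* [unitary_on L T] and [cnu_on L T] are meant for a closed subspace [L] that
   reduces [T]: then the adjoint of [T|_L] is the restriction of the adjoint of
   [T], and a subspace of [L] reduces [T|_L] iff it reduces [T]. *)
Definition unitary_on (R : realType) (H : completeNormedModType R[i])
    (dot : {dot H for Num.conj}) (L : set H) (T : H -> H) : Prop :=
  forall x : H, L x -> adjoint dot T (T x) = x /\ T (adjoint dot T x) = x.

Definition cnu_on (R : realType) (H : completeNormedModType R[i])
    (dot : {dot H for Num.conj}) (L : set H) (T : H -> H) : Prop :=
  contraction_on L T /\
  ~ (exists M : set H,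
       [/\ closed_subspace M, M `<=` L, M != [set 0],
           reduces dot M T & unitary_on dot M T]).

Inductive op_type : Set := A_u | A_cnu.

Definition has_type_on (R : realType) (H : completeNormedModType R[i])
    (dot : {dot H for Num.conj}) (L : set H) (a : op_type) (T : H -> H) : Prop :=
  match a with
  | A_u => unitary_on dot L T
  | A_cnu => cnu_on dot L T
  end.

(* The diagonal entries [Q i i] are not part of the family [Q]: nothing is ever
   assumed or claimed about them. *)
Definition doubly_Q_commuting (R : realType) (H : completeNormedModType R[i])
    (dot : {dot H for Num.conj}) (n : nat)
    (T : 'I_n -> {linear H -> H}) (Q : 'I_n -> 'I_n -> {linear H -> H}) : Prop :=
  [/\ (forall i j, i != j ->
         [/\ bounded_operator (Q i j), unitary_on dot setT (Q i j)
           & Q i j =1 adjoint dot (Q j i)]),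
      (forall i j k l, i != j -> k != l ->
         Q i j \o Q k l =1 Q k l \o Q i j),
      (forall i j, i != j -> T i \o T j =1 Q i j \o T j \o T i),
      (forall i j, i != j ->
         T i \o adjoint dot (T j)
           =1 adjoint dot (Q i j) \o adjoint dot (T j) \o T i)
    & (forall i j k, i != j -> T k \o Q i j =1 Q i j \o T k)].

Definition joint_reducing (R : realType) (H : completeNormedModType R[i])
    (dot : {dot H for Num.conj}) (n : nat)
    (T : 'I_n -> {linear H -> H}) (Q : 'I_n -> 'I_n -> {linear H -> H})
    (L : set H) : Prop :=
  [/\ closed_subspace L, (forall i, reduces dot L (T i))
    & (forall i j, i != j -> reduces dot L (Q i j))].

Definition largest (H : Type) (P : set H -> Prop) (L : set H) : Prop :=
  P L /\ forall M : set H, P M -> M `<=` L.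

Definition orthogonal_sum (R : realType) (H : completeNormedModType R[i])
    (dot : {dot H for Num.conj}) (m : nat) (K : 'I_m -> set H) : Prop :=
  (forall j l, j != l -> forall x y, K j x -> K l y -> dot x y = 0) /\
  (forall x : H, exists y : 'I_m -> H,
     (forall j, K j (y j)) /\ x = \sum_(j < m) y j).

Lemma exp2_gt0 (n : nat) : (0 < 2 ^ n)%N.
Proof. by rewrite expn_gt0. Qed.

Definition first_index (n : nat) : 'I_(2 ^ n) := Ordinal (exp2_gt0 n).
Definition last_index (n : nat) : 'I_(2 ^ n) := rev_ord (first_index n).

(* Main.v *)
(** The unitary part [U] of an operator [A] is the orthogonal complement of the
    vectors [w (A^* A z - z)] and [w (A A^* z - z)], with [w] a word in [A] and
    [A^*]. It is the largest set stable under [A] and [A^*] on which [A] is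
    unitary. For a doubly [Q]-commuting tuple, [T_j] maps [U_i] onto a set
    stable under [T_i] and [T_i^*] on which [T_i] is unitary, since moving [T_i]
    and [T_i^*] past [T_j] only costs factors [Q_ij] and [Q_ji] that cancel; the
    same holds for [T_j^*] and for the [Q_jk], so every [U_i] is joint reducing.
    If a closed subspace [M] reduces [A], then the components in [M] and its
    orthogonal complement of a vector of [U] are again in [U]. Hence the
    orthogonal projections on the [U_i] commute, and the [2^n] intersections of
    the [U_i] and their complements span [H]. *)
Require Import Defs.
From HB Require Import structures.
From mathcomp Require Import all_boot all_order all_algebra.
From mathcomp Require Import perm complex sesquilinear.
From mathcomp Require Import all_classical all_reals all_analysis.
From mathcomp Require Import ring.

Set Implicit Arguments.
Unset Strict Implicit.
Unset Printing Implicit Defensive.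

Import Order.TTheory GRing.Theory Num.Theory.
Import numFieldNormedType.Exports.

Local Open Scope classical_set_scope.
Local Open Scope ring_scope.
Local Open Scope complex_scope.

(** * Epsilon criteria for closedness and for vanishing *)

Lemma closed_approx (K : numFieldType) (V : normedModType K) (L : set V) :
  closed L <->
  forall x, (forall e : K, 0 < e -> exists2 y, L y & `|x - y| < e) -> L x.
Proof.
split=> [clL x Lx|Lapprox x clx].
  apply: clL => B /nbhs_normP[e /= e0 eB].
  by have [y Ly xy] := Lx e e0; exists y; split => //; exact: eB.
apply: Lapprox => e e0.
have [|y [Ly xy]] := clx [set y | `|x - y| < e]; last by exists y.
by apply/nbhs_normP; exists e.
Qed.

Lemma le_eps_mul_eq0 (K : numFieldType) (a b : K) : 0 <= a ->
  (forall e, 0 < e -> a <= e * b) -> a = 0.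
Proof.
move=> a0 ab; have [an0|//] := boolP (a != 0); last by rewrite negbK => /eqP.
have ap : 0 < a by rewrite lt_def an0.
have bp : 0 < b by rewrite (lt_le_trans ap)// -[b]mul1r ab.
(* This choice of [e] turns the bound into [a <= a / 2], impossible for [a > 0]. *)
have := ab (a / (b * 2)) ltac:(by rewrite divr_gt0 ?mulr_gt0).
rewrite invfM mulrA mulrAC divfK ?gt_eqF// ler_pdivlMr// mulrDr mulr1.
by rewrite gerDl => a_le0; apply/le_anti; rewrite a_le0.
Qed.

(** * Hilbert space geometry: orthogonal projection, Riesz representation, adjoints *)

Section inner.
Variables (R : realType) (H : completeNormedModType R[i]).
Variables (dot : {dot H for Num.conj}) (dot_norm : hilbert_dot dot).
Implicit Types (x y z u v w : H) (L M : set H) (a e : R[i]).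

Lemma dotDl z : {morph dot^~ z : x y / x + y}. Proof. exact: linearDl. Qed.
Lemma dotDr z : {morph dot z : x y / x + y}. Proof. exact: linearDr. Qed.
Lemma dotBl z : {morph dot^~ z : x y / x - y}. Proof. exact: linearBl. Qed.
Lemma dotBr z : {morph dot z : x y / x - y}. Proof. exact: linearBr. Qed.
Lemma dotZl a x z : dot (a *: x) z = a * dot x z. Proof. exact: linearZl_LR. Qed.
Lemma dotZr a x z : dot x (a *: z) = Num.conj a * dot x z.
Proof. exact: linearZr_LR. Qed.
Lemma dot0l z : dot 0 z = 0. Proof. exact: linear0l. Qed.
Lemma dot0r z : dot z 0 = 0. Proof. exact: linear0r. Qed.
Lemma dotC x y : dot x y = Num.conj (dot y x).
Proof. by rewrite hermC expr0 mul1r. Qed.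
Lemma dotC0 x y : dot x y = 0 -> dot y x = 0.
Proof. by rewrite dotC => /eqP; rewrite conjC_eq0 => /eqP. Qed.
Lemma dot_eq0 x : dot x x = 0 -> x = 0.
Proof. by move/eqP; rewrite dnorm_eq0 => /eqP. Qed.

Lemma normE x : `|x| ^+ 2 = dot x x.
Proof. exact: dot_norm. Qed.

(** Pythagoras: the vector subtracted is the projection of [w] on the line of [z]. *)
Lemma norm_subZ_sqr w z : z != 0 ->
  `|w - (dot w z / `|z| ^+ 2) *: z| ^+ 2 =
  `|w| ^+ 2 - (`|dot w z| / `|z|) ^+ 2.
Proof.
move=> z0; have nz : `|z| != 0 by rewrite normr_eq0.
have zR : Num.conj (`|z| ^+ 2) = `|z| ^+ 2.
  by rewrite conj_Creal// realX// normr_real.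
set t := _ / _; have dt : dot w (t *: z) = (`|dot w z| / `|z|) ^+ 2.
  rewrite dotZr /t rmorphM fmorphV/= zR.
  by rewrite mulrAC [Num.conj _ * _]mulrC -normCK expr_div_n.
rewrite [LHS]normE dnormB dnormZ -!normE dt conj_Creal; last first.
  by rewrite realX// realM ?realV ?normr_real.
by rewrite /t normrM normfV normrX normr_id; field.
Qed.

(** Minimality tested at the projection coefficient of [w] on [z] leaves exactly this bound. Taking
    [e] to be the norm of [w] gives Cauchy-Schwarz; a small [e] makes near-minimisers almost
    orthogonal to [z]. *)
Lemma dot_le_of_minimal w z e : 0 <= e ->
  (forall a, `|w| ^+ 2 <= `|w - a *: z| ^+ 2 + e ^+ 2) ->
  `|dot w z| <= e * `|z|.
Proof.
move=> e0 min; have [->|z0] := eqVneq z 0; first by rewrite dot0r !normr0 mulr0.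
have := min (dot w z / `|z| ^+ 2); rewrite norm_subZ_sqr// addrAC -addrA lerDl.
rewrite subr_ge0 ler_sqr ?nnegrE ?divr_ge0//.
by rewrite ler_pdivrMr// normr_gt0.
Qed.

Lemma cauchy_schwarz x y : `|dot x y| <= `|x| * `|y|.
Proof.
by apply: dot_le_of_minimal => // a; rewrite lerDr exprn_ge0.
Qed.

Lemma parallelogram x y :
  `|x + y| ^+ 2 + `|x - y| ^+ 2 = 2 * (`|x| ^+ 2 + `|y| ^+ 2).
Proof. by rewrite !normE dnormD dnormB; ring. Qed.

(** The order of [R[i]] is only partial, so the infimum of the squared distances is taken over their
    real parts in [R] and sent back to [R[i]]. *)
Lemma distance_sqr x L : L !=set0 -> exists2 d : R[i],
  (forall y, L y -> d <= `|x - y| ^+ 2) &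
  forall e, 0 < e -> exists2 y, L y & `|x - y| ^+ 2 < d + e.
Proof.
move=> [y0 Ly0].
pose S := [set complex.Re (`|x - y| ^+ 2) | y in L].
have Re_norm u : (complex.Re (`|u| ^+ 2))%:C = `|u| ^+ 2.
  by rewrite RRe_real// realX// normr_real.
have Slb : lbound S 0.
  move=> _ [y Ly <-]; have : 0 <= `|x - y| ^+ 2 by rewrite exprn_ge0.
  by rewrite lecE => /andP[].
exists (inf S)%:C => [y Ly|e e0].
  rewrite -Re_norm lecR; apply: ge_inf; first by exists 0.
  by exists y.
have eR : (complex.Re e)%:C = e by rewrite RRe_real// gtr0_real.
have [||_ [y Ly <-] ye] := @inf_adherent _ S (complex.Re e).
- by rewrite -ltcR eR.
- by split; [exists (complex.Re (`|x - y0| ^+ 2)); exists y0|exists 0].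
by exists y => //; rewrite -Re_norm -eR -rmorphD/= ltcR.
Qed.

Definition orth L : set H := [set x | forall y, L y -> dot x y = 0].

(** By the parallelogram law the near-minimisers of the distance to [x] form a Cauchy filter, whose
    limit is the foot of the perpendicular. *)
Lemma proj_exists L : closed_subspace L -> forall x,
  exists2 y, L y & orth L (x - y).
Proof.
move=> [clL L0 Llin] x.
have [|d d_le d_adh] := @distance_sqr x L; first by exists 0.
(* The tolerance is [e ^+ 2], so that the diameter of [S e] is linear in [e]. *)
pose S e := [set y | L y /\ `|x - y| ^+ 2 < d + e ^+ 2].
pose F := filter_from [set e : R[i] | 0 < e] S.
have S_close e y y' : 0 < e -> S e y -> S e y' -> `|y - y'| < 2 * e.
  move=> e0 [Ly xy] [Ly' xy'].
  (* The midpoint of [y] and [y'] lies in [L], hence at squared distance at least [d] from [x]; this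
     leaves less than [4 * e ^+ 2] for the squared norm of [y - y']. *)
  have := parallelogram (x - y') (x - y).
  have -> : x - y' - (x - y) = y - y' by rewrite opprB addrC addrA subrK.
  have -> : x - y' + (x - y) = 2 *: (x - (2^-1 *: y + 2^-1 *: y')).
    rewrite scalerBr scalerDr !scalerA mulfV ?pnatr_eq0// !scale1r.
    by rewrite scalerDl scale1r opprD addrACA [- y + _]addrC.
  have Lm : L (2^-1 *: y + 2^-1 *: y').
    by apply: (Llin) => //; rewrite -[_ *: y']addr0; apply: (Llin).
  move: (d_le _ Lm); rewrite normrZ exprMn normr_nat => dm h.
  rewrite -ltr_sqr ?nnegrE ?mulr_ge0 ?(ltW e0)//.
  rewrite -(ltrD2l (2 ^+ 2 * `|x - (2^-1 *: y + 2^-1 *: y')| ^+ 2)) h.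
  apply: (@lt_le_trans _ _ (2 * ((d + e ^+ 2) + (d + e ^+ 2)))).
    by rewrite ltr_pM2l// ltrD.
  have -> : 2 * (d + e ^+ 2 + (d + e ^+ 2)) = 2 ^+ 2 * d + (2 * e) ^+ 2 by ring.
  by rewrite lerD2r ler_pM2l ?exprn_gt0.
have S_mono e e' : 0 < e -> e <= e' -> S e `<=` S e'.
  move=> e0 ee' y [Ly xy]; split => //; apply: lt_le_trans xy _.
  by rewrite lerD2l ler_sqr// nnegrE ltW// (lt_le_trans e0).
have Fproper : ProperFilter F.
  apply: filter_from_proper.
    apply: filter_from_filter; first by exists 1 => /=.
    move=> e1 e2 /= e10 e20.
    (* Positive elements of [R[i]] are real, hence comparable. *)
    have [le12|le21] := orP (real_leVge (gtr0_real e10) (gtr0_real e20)).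
      by exists e1 => // y Sy; split => //; exact: S_mono le12 _ Sy.
    by exists e2 => // y Sy; split => //; exact: S_mono le21 _ Sy.
  move=> e /= e0; have [|y Ly xy] := d_adh (e ^+ 2); first by rewrite exprn_gt0.
  by exists y.
have Fl : F --> lim F.
  apply: cauchy_cvg; apply: cauchy_exP => e e0.
  have e20 : 0 < e / 2 by rewrite divr_gt0.
  have [|y Ly xy] := d_adh ((e / 2) ^+ 2); first by rewrite exprn_gt0.
  exists y; exists (e / 2) => //= y' Sy'.
  rewrite -ball_normE/= -[e](divfK (_ : 2 != 0)) ?pnatr_eq0// mulrC.
  by apply: S_close Sy' => //; split.
have near_l e : 0 < e -> exists2 y, S e y & `|lim F - y| < e.
  move=> e0; have Se : F (S e) by exists e.
  have /(_ _ _ e0) Fe := (fcvgrPdist_lt (lim F)).1 Fl.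
  by have [y [Sy ly]] := filter_ex (filterI Se Fe); exists y.
exists (lim F).
  apply: (closed_approx L).1 => // e e0.
  by have [y [Ly _] ly] := near_l e e0; exists y.
(* A near-minimiser [y] close to the limit gives two errors of size [e * |z|]: one from the
   near-minimality of [x - y], one from Cauchy-Schwarz for [lim F - y]. *)
move=> z Lz; apply/normr0_eq0/(@le_eps_mul_eq0 _ _ (2 * `|z|)) => // e e0.
have [y [Ly xy] ly] := near_l e e0.
have -> : x - lim F = (x - y) - (lim F - y) by rewrite opprB addrA subrK.
rewrite dotBl (le_trans (ler_normB _ _))//.
rewrite mulrA [e * 2]mulr_natr mulr2n mulrDl lerD//; last first.
  by rewrite (le_trans (cauchy_schwarz _ _))// ler_wpM2r// ltW.
apply: dot_le_of_minimal => [|a]; first exact: ltW.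
rewrite (le_trans (ltW xy))// lerD2r -addrA -opprD; apply: d_le.
by rewrite addrC; exact: Llin.
Qed.

(** The kernel is closed by the bound; let [w] be nonzero and orthogonal to it. Since
    [f w *: x - f x *: w] is in the kernel, [f w * dot x w = f x * dot w w], which dictates [z]. *)
Lemma riesz (f : H -> R[i]) (C : R[i]) : 0 <= C ->
    (forall a x y, f (a *: x + y) = a * f x + f y) ->
    (forall x, `|f x| <= C * `|x|) ->
  exists z, forall x, f x = dot x z.
Proof.
move=> C0 flin fC.
have f0 : f 0 = 0.
  have := flin 1 0 0; rewrite scale1r add0r mul1r => /eqP.
  by rewrite eq_sym -subr_eq0 addrK => /eqP.
have fN x : f (- x) = - f x by rewrite -[- x]addr0 -scaleN1r flin f0 addr0 mulN1r.
have fB x y : f (x - y) = f x - f y by rewrite -[x]scale1r flin mul1r fN scale1r.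
have ker_closed : closed_subspace (f @^-1` [set 0]).
  split=> [|//|a x y /= fx fy]; last by rewrite flin fx fy mulr0 addr0.
  apply/closed_approx => x fx; apply/normr0_eq0/(@le_eps_mul_eq0 _ _ C) => // e e0.
  have [y /= fy xy] := fx e e0.
  rewrite -[f x]subr0 -fy -fB (le_trans (fC _))// mulrC ler_wpM2r//; exact: ltW.
have [f_eq0|/existsNP[x0 fx0]] := pselect (forall x, f x = 0).
  by exists 0 => x; rewrite dot0r.
have [y /= fy wL] := proj_exists ker_closed x0; set w := x0 - y in wL.
have fw : f w = f x0 by rewrite fB fy subr0.
have w0 : w != 0 by apply/eqP => w0; apply: fx0; rewrite -fw w0.
have ww0 : dot w w != 0 by rewrite dnorm_eq0.
exists ((Num.conj (f w) / dot w w) *: w) => x.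
have : dot w (f w *: x - f x *: w) = 0.
  apply: wL; rewrite /= fB -[f w *: x]addr0 -[f x *: w]addr0 !flin f0.
  by rewrite !addr0 mulrC subrr.
move/dotC0/eqP; rewrite dotBl !dotZl subr_eq0 => /eqP fxw.
rewrite dotZr rmorphM fmorphV/= conjCK [Num.conj (dot w w)]conj_Creal ?ger0_real//.
by rewrite mulrAC fxw mulfK.
Qed.

Lemma bounded_operatorP (T : {linear H -> H}) : bounded_operator T ->
  exists2 C : R[i], 0 <= C & forall x, `|T x| <= C * `|x|.
Proof.
rewrite /bounded_operator /opnorm_on; set S := (X in ereal_sup X) => Soo.
have Sub x : `|x| <= 1 -> ((complex.Re `|T x|)%:E <= ereal_sup S)%E.
  by move=> x1; apply: ereal_sup_ubound; exists x.
have := Sub 0; rewrite raddf0 !normr0 ler01 => /(_ isT) S0.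
have Sfin : ereal_sup S \is a fin_num by rewrite ge0_fin_numE.
exists (fine (ereal_sup S))%:C; first by rewrite lecR fine_ge0.
move=> x; have [->|x0] := eqVneq x 0; first by rewrite raddf0 !normr0 mulr0.
have nx : 0 < `|x| by rewrite normr_gt0.
have := Sub (`|x|^-1 *: x); rewrite linearZ/= !normrZ normfV normr_id mulVf ?gt_eqF//.
move=> /(_ (lexx _)); rewrite -(fineK Sfin) lee_fin -lecR.
by rewrite RRe_real ?ger0_real ?mulr_ge0 ?invr_ge0// mulrC ler_pdivrMr.
Qed.

(** A relation between two maps makes [A] and [B] interchangeable, and lets [Q j i] serve directly
    as the adjoint of [Q i j]. *)
Definition adjoint_pair (A B : H -> H) := forall x y, dot (A x) y = dot x (B y).

(** Riesz, applied to [dot (T x) y] as a functional of [x], shows that the vector chosen in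
    [adjoint] has its defining property. *)
Lemma adjointP (T : {linear H -> H}) : bounded_operator T ->
  adjoint_pair T (adjoint dot T).
Proof.
move=> /bounded_operatorP[C C0 TC] x y.
suff [z Tz] : exists z, forall x, dot (T x) y = dot x z.
  by have /(_ x) := @getPex _ [set z | forall x, dot (T x) y = dot x z] (ex_intro _ z Tz).
apply: (@riesz _ (C * `|y|)) => [|a u v|u].
- exact: mulr_ge0.
- by rewrite linearP dotDl dotZl.
- by rewrite (le_trans (cauchy_schwarz _ _))// mulrAC ler_wpM2r.
Qed.

Lemma contraction_bounded (T : {linear H -> H}) :
  contraction_on setT T -> bounded_operator T.
Proof. by move=> T1; apply: le_lt_trans T1 (ltry _). Qed.

End inner.

(** * The unitary part of a single operator *)

Section parts.
Variables (R : realType) (H : completeNormedModType R[i]).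
Variables (dot : {dot H for Num.conj}) (dot_norm : hilbert_dot dot).
Implicit Types (x y z u v w : H) (L M N : set H) (a e : R[i]) (A B C P : H -> H).

Local Notation orth := (orth dot).
Local Notation adjoint_pair := (adjoint_pair dot).

Lemma subspaceD L x y : closed_subspace L -> L x -> L y -> L (x + y).
Proof. by move=> [_ _ Llin] Lx Ly; rewrite -[x]scale1r; apply: (Llin). Qed.

Lemma subspaceB L x y : closed_subspace L -> L x -> L y -> L (x - y).
Proof. by move=> [_ _ Llin] Lx Ly; rewrite addrC -scaleN1r; apply: (Llin). Qed.

Lemma subspaceI L M :
  closed_subspace L -> closed_subspace M -> closed_subspace (L `&` M).
Proof.
move=> [clL L0 Llin] [clM M0 Mlin]; split; [exact: closedI|by []|].
by move=> a x y [Lx Mx] [Ly My]; split; [exact: Llin|exact: Mlin].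
Qed.

Lemma orth_closed_subspace L : closed_subspace (orth L).
Proof.
split=> [|y _|a x y Lx Ly z Lz]; last by rewrite dotDl dotZl Lx// Ly// mulr0 addr0.
- apply/closed_approx => x xL z Lz.
  apply/normr0_eq0/(@le_eps_mul_eq0 _ _ `|z|) => // e e0.
  have [y yL xy] := xL e e0.
  rewrite -[dot x z]subr0 -(yL _ Lz) -dotBl (le_trans (cauchy_schwarz dot_norm _ _))//.
  by rewrite ler_wpM2r// ltW.
- by rewrite dot0l.
Qed.

Lemma orth_self x L : L x -> orth L x -> x = 0.
Proof. by move=> Lx /(_ x Lx); exact: dot_eq0. Qed.

Lemma dot_inj x y : (forall z, dot x z = dot y z) -> x = y.
Proof.
move=> xy; apply/eqP; rewrite -subr_eq0; apply/eqP/(@dot_eq0 _ _ dot).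
by rewrite dotBl xy subrr.
Qed.

Lemma adjoint_pairC A B : adjoint_pair A B -> adjoint_pair B A.
Proof. by move=> AB x y; rewrite dotC -AB -dotC. Qed.

Lemma adjoint_pairD A B : adjoint_pair A B -> {morph A : x y / x + y}.
Proof. by move=> AB x y; apply: dot_inj => z; rewrite AB !dotDl !AB. Qed.

Definition stable L A := forall x, L x -> L (A x).

Definition unitary_pair_on L A B := forall x, L x -> B (A x) = x /\ A (B x) = x.

Lemma orth_stable L A B :
  adjoint_pair A B -> stable L B -> stable (orth L) A.
Proof. by move=> AB LB x Lx y Ly; rewrite AB Lx//; exact: LB. Qed.

(** Words are generated letter by letter, so that orthogonality to all of them is proved by
    induction; the orthogonal complement does not see linear combinations. *)
Inductive defect A B : set H :=
| defect_BA z : defect A B (B (A z) - z)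
| defect_AB z : defect A B (A (B z) - z)
| defect_A d : defect A B d -> defect A B (A d)
| defect_B d : defect A B d -> defect A B (B d).

Definition unitary_part A B := orth (defect A B).

Lemma unitary_part_subspace A B : closed_subspace (unitary_part A B).
Proof. exact: orth_closed_subspace. Qed.

Section fixed_pair.
Variables A B : H -> H.
Hypothesis AB : adjoint_pair A B.
Local Notation U := (unitary_part A B).

Lemma unitary_part_stablel : stable U A.
Proof. by apply: (orth_stable AB) => d; exact: defect_B. Qed.

Lemma unitary_part_stabler : stable U B.
Proof. by apply: (orth_stable (adjoint_pairC AB)) => d; exact: defect_A. Qed.

(** [B \o A] and [A \o B] are self-adjoint, so pairing [B (A x) - x] with [z] is pairing [x] with a
    generator of the defect. *)
Lemma unitary_part_unitary : unitary_pair_on U A B.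
Proof.
have BA := adjoint_pairC AB; move=> x Ux; split; apply: dot_inj => z.
- by apply/eqP; rewrite BA AB -subr_eq0 -dotBr Ux//; exact: defect_BA.
- by apply/eqP; rewrite AB BA -subr_eq0 -dotBr Ux//; exact: defect_AB.
Qed.

(** Induction on the word: each letter is moved to the other side of [dot], where stability of [M]
    absorbs it, and unitarity kills the generators. [M] is an arbitrary set, so the image of [U]
    under an operator can be taken for it. *)
Lemma unitary_part_max M : stable M A -> stable M B ->
  unitary_pair_on M A B -> M `<=` U.
Proof.
have BA := adjoint_pairC AB; move=> MA MB MU x Mx d Dd.
elim: Dd x Mx => {d} [z|z|d _ IH|d _ IH] x Mx.
- by rewrite dotBr -AB -BA (MU _ Mx).1 subrr.
- by rewrite dotBr -BA -AB (MU _ Mx).2 subrr.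
- by rewrite -BA IH//; exact: MB.
- by rewrite -AB IH//; exact: MA.
Qed.

(** Maximality is applied to the set of [M]-components of vectors of [U]: [A] and [B] act
    componentwise, and uniqueness of components carries unitarity over from [U]. *)
Lemma unitary_part_summand M N x y : closed_subspace M -> closed_subspace N ->
  stable M A -> stable M B -> stable N A -> stable N B ->
  (forall m n, M m -> N n -> dot m n = 0) ->
  M x -> N y -> U (x + y) -> U x.
Proof.
move=> Msub Nsub MA MB NA NB MN Mx Ny Uxy.
have AD := adjoint_pairD AB; have BD := adjoint_pairD (adjoint_pairC AB).
(* The vector [p - m = n - q] lies in both [M] and [N], so it is orthogonal to itself. *)
have cmp p q m n : M p -> N q -> M m -> N n -> p + q = m + n -> p = m.
  move=> Mp Nq Mm Nn pq; apply/eqP; rewrite -subr_eq0; apply/eqP.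
  have pm : p - m = n - q.
    by apply/eqP; rewrite subr_eq addrAC eq_sym subr_eq pq addrC.
  apply: (@dot_eq0 _ _ dot); rewrite {2}pm; apply: MN; exact: subspaceB.
apply: (@unitary_part_max [set m | M m /\ exists2 n, N n & U (m + n)]); last first.
- by split => //; exists y.
- move=> m [Mm [n Nn Umn]]; have [e1 e2] := unitary_part_unitary Umn.
  split; [apply: (cmp _ (B (A n)) _ n)|apply: (cmp _ (A (B n)) _ n)] => //;
    do ?[exact: MA|exact: MB|exact: NA|exact: NB|apply: MA|apply: MB|apply: NA|apply: NB].
  + by rewrite -BD -AD.
  + by rewrite -AD -BD.
- move=> m [Mm [n Nn Umn]]; split; first exact: MB.
  by exists (B n); [exact: NB|rewrite -BD; exact: unitary_part_stabler].
- move=> m [Mm [n Nn Umn]]; split; first exact: MA.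
  by exists (A n); [exact: NA|rewrite -AD; exact: unitary_part_stablel].
Qed.

Lemma unitary_part_split M u : closed_subspace M ->
  stable M A -> stable M B -> U u ->
  exists v w, [/\ M v, U v, orth M w, U w & u = v + w].
Proof.
move=> Msub MA MB Uu; have [v Mv Mw] := proj_exists dot_norm Msub u.
have OA := orth_stable AB MB; have OB := orth_stable (adjoint_pairC AB) MA.
have Osub := orth_closed_subspace M.
exists v, (u - v); split => //; last by rewrite addrC subrK.
- apply: (unitary_part_summand Msub Osub MA MB OA OB _ Mv Mw); last first.
    by rewrite addrC subrK.
  by move=> m n Mm Mn; apply: dotC0; exact: Mn.
- apply: (unitary_part_summand Osub Msub OA OB MA MB _ Mw Mv); last by rewrite subrK.
  by move=> m n Mm; exact: Mm.
Qed.

(** [C] commutes with [A] and [B] up to the mutually inverse factors [P] and [P']. They cancel in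
    [B (A (C y))] and [A (B (C y))], so the image of [U] under [C] falls under maximality. *)
Lemma unitary_part_stable C P P' :
    stable U P -> stable U P' ->
    (forall x, A (P' x) = P' (A x)) -> (forall x, B (P x) = P (B x)) ->
    (forall x, P (P' x) = x) -> (forall x, P' (P x) = x) ->
    (forall x, A (C x) = C (P (A x))) -> (forall x, B (C x) = C (P' (B x))) ->
  stable U C.
Proof.
move=> UP UP' AP' BP PK P'K AC BC x Ux.
apply: (@unitary_part_max (C @` U)); last by exists x.
- move=> _ [y Uy <-]; rewrite AC; eexists; last reflexivity.
  exact/UP/unitary_part_stablel.
- move=> _ [y Uy <-]; rewrite BC; eexists; last reflexivity.
  exact/UP'/unitary_part_stabler.
- move=> _ [y Uy <-]; have [BAy ABy] := unitary_part_unitary Uy.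
  by rewrite AC BC BP P'K BAy BC AC AP' PK ABy.
Qed.

(** The intersection of [M] and [U] is such an [N], hence zero. Splitting a vector of [U] along [M]
    therefore leaves only a component orthogonal to [M]. *)
Lemma orth_unitary_part_max M : closed_subspace M ->
    stable M A -> stable M B ->
    (forall N, closed_subspace N -> N `<=` M -> stable N A -> stable N B ->
       unitary_pair_on N A B -> N = [set 0]) ->
  M `<=` orth U.
Proof.
move=> Msub MA MB MU0 m Mm d Ud.
have N0 : M `&` U = [set 0].
  apply: MU0 => [|x []//|x [Mx Ux]|x [Mx Ux]|x [_ Ux]].
  - exact: subspaceI (unitary_part_subspace _ _).
  - by split; [exact: MA|exact: unitary_part_stablel].
  - by split; [exact: MB|exact: unitary_part_stabler].
  - exact: unitary_part_unitary.
have [v [w [Mv Uv Mw _ ->]]] := unitary_part_split Msub MA MB Ud.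
have -> : v = 0 by have : (M `&` U) v by []; rewrite N0.
by rewrite add0r; apply/dotC0/Mw.
Qed.

End fixed_pair.
End parts.

(** * Numbering the sign patterns *)

(** Any bijection is corrected by two transpositions; the second one fixes [b1] if [a1] and [a2]
    differ, and is trivial otherwise. *)
Lemma bijective_two_points (A B : finType) (a1 a2 : A) (b1 b2 : B) :
  #|A| = #|B| -> (a1 == a2) = (b1 == b2) ->
  exists2 f : A -> B, bijective f & f a1 = b1 /\ f a2 = b2.
Proof.
move=> AB ab; pose g x := tperm (enum_val (cast_ord AB (enum_rank a1))) b1
  (enum_val (cast_ord AB (enum_rank x))) : B.
have gbij : bijective g.
  apply: bij_comp; first exact: inv_bij (tpermK _ _).
  apply: bij_comp; first exact: enum_val_bij.
  apply: bij_comp (enum_rank_bij _).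
  by exists (cast_ord (esym AB)); [exact: cast_ordK|exact: cast_ordKV].
have ga1 : g a1 = b1 by rewrite /g tpermL.
exists (fun x => tperm (g a2) b2 (g x)).
  exact: bij_comp (inv_bij (tpermK _ _)) gbij.
split; last by rewrite tpermL.
rewrite ga1; have [a12|a12] := eqVneq a1 a2.
  by rewrite -a12 ga1; move: ab; rewrite a12 eqxx => /esym/eqP <-; rewrite tperm1 perm1.
rewrite tpermD//; last by rewrite eq_sym -ab.
by rewrite -ga1 (bij_eq gbij) eq_sym.
Qed.

Lemma sign_pattern_index n : exists f : {ffun 'I_n -> bool} -> 'I_(2 ^ n),
  [/\ bijective f, f [ffun=> false] = first_index n & f [ffun=> true] = last_index n].
Proof.
have [|| f fbij [f0 f1]] := @bijective_two_points {ffun 'I_n -> bool} 'I_(2 ^ n)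
  [ffun=> false] [ffun=> true] (first_index n) (last_index n); last by exists f.
- by rewrite card_ffun card_bool !card_ord.
(* For [n = 0] the two constant patterns coincide, and so do the first and last index. *)
- rewrite -val_eqE /= subn1; case: n => [|n].
    by apply/eqP/ffunP => -[].
  rewrite [RHS]ltn_eqF; last by rewrite -ltnS prednK ?expn_gt0// (ltn_exp2l 0).
  by apply/negP => /eqP/ffunP/(_ ord0); rewrite !ffunE.
Qed.

(** * Joint parts of a doubly Q-commuting tuple *)

Section decomposition.
Variables (R : realType) (H : completeNormedModType R[i]).
Variables (dot : {dot H for Num.conj}) (dot_norm : hilbert_dot dot) (n : nat).
Variables (T : 'I_n -> {linear H -> H}) (Q : 'I_n -> 'I_n -> {linear H -> H}).
Hypothesis T_contr : forall i, contraction_on setT (T i).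
Hypothesis TQ : doubly_Q_commuting dot T Q.

Local Notation orth := (orth dot).
Local Notation adjoint_pair := (adjoint_pair dot).

Let T_adj k : adjoint_pair (T k) (adjoint dot (T k)).
Proof. exact/(adjointP dot_norm)/contraction_bounded. Qed.

Let Q_adj i j : i != j -> adjoint_pair (Q i j) (Q j i).
Proof.
case: TQ => Qu _ _ _ _ ij x y; have [Qb _ _] := Qu i j ij.
by have [_ _ ->] := Qu j i ltac:(by rewrite eq_sym); exact: (adjointP dot_norm Qb).
Qed.

Let QK i j x : i != j -> Q j i (Q i j x) = x.
Proof.
case: TQ => Qu _ _ _ _ ij; have [_ Qun _] := Qu i j ij.
by have [_ _ ->] := Qu j i ltac:(by rewrite eq_sym); have [] := Qun x.
Qed.

Let TQE k i j x : i != j -> T k (Q i j x) = Q i j (T k x).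
Proof. by case: TQ => _ _ _ _ + ij => /(_ i j k ij x). Qed.

(** The adjoint of [TQE] for the pair [j], [i]. *)
Let T'QE k i j x : i != j ->
  adjoint dot (T k) (Q i j x) = Q i j (adjoint dot (T k) x).
Proof.
move=> ij; have ji : j != i by rewrite eq_sym.
apply: (@dot_inj _ _ dot) => z.
by rewrite !(adjoint_pairC (T_adj k), Q_adj ij) TQE.
Qed.

(** This and the next three exchange rules have the factor [Q] in the inner position required by
    [unitary_part_stable]. The first two restate hypotheses, [T'T] inverts [TT'], and [T'T'] is dual
    to [TT]. *)
Let TT i j x : i != j -> T i (T j x) = T j (Q i j (T i x)).
Proof. by move=> ij; case: TQ => _ _ + _ _ => /(_ i j ij x)/= ->; rewrite TQE. Qed.

Let TT' i j x : i != j ->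
  T i (adjoint dot (T j) x) = adjoint dot (T j) (Q j i (T i x)).
Proof.
move=> ij; have ji : j != i by rewrite eq_sym.
case: TQ => Qu _ _ + _ => /(_ i j ij x)/= ->.
by rewrite T'QE//; have [_ _ ->] := Qu j i ji.
Qed.

Let T'T i j x : i != j ->
  adjoint dot (T i) (T j x) = T j (Q j i (adjoint dot (T i) x)).
Proof.
move=> ij; have ji : j != i by rewrite eq_sym.
by rewrite TQE// TT'// -T'QE// QK.
Qed.

Let T'T' i j x : i != j ->
  adjoint dot (T i) (adjoint dot (T j) x) =
  adjoint dot (T j) (Q i j (adjoint dot (T i) x)).
Proof.
move=> ij; have ji : j != i by rewrite eq_sym.
apply: (@dot_inj _ _ dot) => z.
rewrite !(adjoint_pairC (T_adj _)) Q_adj// (adjoint_pairC (T_adj _)).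
by rewrite TT// TQE.
Qed.

Local Notation U k := (unitary_part dot (T k) (adjoint dot (T k))).

Let U_Q k i j : i != j -> stable (U k) (Q i j).
Proof.
move=> ij.
apply: (unitary_part_stable (T_adj k) (C := Q i j) (P := id) (P' := id)) => // x /=.
- exact: TQE.
- exact: T'QE.
Qed.

Let U_T k l : stable (U k) (T l).
Proof.
have [->|kl] := eqVneq l k; first exact: unitary_part_stablel (T_adj k).
have lk : k != l by rewrite eq_sym.
apply: (unitary_part_stable (T_adj k) (U_Q lk) (U_Q kl)) => x.
- exact: TQE.
- exact: T'QE.
- exact: QK.
- exact: QK.
- exact: TT.
- exact: T'T.
Qed.

Let U_T' k l : stable (U k) (adjoint dot (T l)).
Proof.
have [->|kl] := eqVneq l k; first exact: unitary_part_stabler (T_adj k).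
have lk : k != l by rewrite eq_sym.
apply: (unitary_part_stable (T_adj k) (U_Q kl) (U_Q lk)) => x.
- exact: TQE.
- exact: T'QE.
- exact: QK.
- exact: QK.
- exact: TT'.
- exact: T'T'.
Qed.

(** The adjoint of [Q i j] is [Q j i], again a member of the family, so stability under the [Q i j]
    covers their adjoints. *)
Let joint_reducingP L : joint_reducing dot T Q L <->
  [/\ closed_subspace L, forall i, stable L (T i),
      forall i, stable L (adjoint dot (T i)) &
      forall i j, i != j -> stable L (Q i j)].
Proof.
case: TQ => Qu _ _ _ _; split=> [[cL LT LQ]|[cL LT LT' LQ]].
  split=> // [i x Lx|i x Lx|i j ij x Lx]; first by have [] := LT i x Lx.
  - by have [] := LT i x Lx.
  - by have [] := LQ i j ij x Lx.
split=> // [i x Lx|i j ij x Lx]; first by split; [exact: LT|exact: LT'].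
have ji : j != i by rewrite eq_sym.
split; first exact: LQ.
by have [_ _ <-] := Qu j i ji; exact: LQ.
Qed.

Definition part k (a : op_type) : set H :=
  match a with A_u => U k | A_cnu => orth (U k) end.

Definition joint_part (theta : 'I_n -> op_type) : set H :=
  [set x | forall k, part k (theta k) x].

Lemma part_joint_reducing k a : joint_reducing dot T Q (part k a).
Proof.
apply/joint_reducingP; case: a => /=; split.
- exact: unitary_part_subspace.
- exact: U_T.
- exact: U_T'.
- exact: U_Q.
- exact: orth_closed_subspace.
- by move=> i; exact: orth_stable (T_adj i) (@U_T' k i).
- by move=> i; exact: orth_stable (adjoint_pairC (T_adj i)) (@U_T k i).
- move=> i j ij; have ji : j != i by rewrite eq_sym.
  exact: orth_stable (Q_adj ij) (U_Q ji).
Qed.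

Lemma joint_part_reducing theta : joint_reducing dot T Q (joint_part theta).
Proof.
have pr k := (joint_reducingP _).1 (part_joint_reducing k (theta k)).
apply/joint_reducingP; split.
- split=> [|k|a x y Lx Ly k].
  + apply/closed_approx => x xL k; have [[/closed_approx cl _ _] _ _ _] := pr k.
    by apply: cl => e /xL[y Ly xy]; exists y.
  + by have [[]] := pr k.
  + by have [[_ _ lin] _ _ _] := pr k; exact: lin.
- by move=> i x Lx k; have [_ + _ _] := pr k; apply.
- by move=> i x Lx k; have [_ _ + _] := pr k; apply.
- by move=> i j ij x Lx k; have [_ _ _ +] := pr k; apply.
Qed.

Lemma joint_part_type theta k : has_type_on dot (joint_part theta) (theta k) (T k).
Proof.
have : joint_part theta `<=` part k (theta k) by move=> x /(_ k).
case: (theta k) => /= sub.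
  by move=> x /sub; exact: (unitary_part_unitary (T_adj k)).
split.
  apply: le_trans (T_contr k); apply: le_ereal_sup => _ [x [_ x1] <-].
  by exists x.
case=> M [Msub Mp /negP M0 MT MU]; apply: M0; apply/eqP/seteqP.
split=> [x Mx|_ ->]; last by case: Msub.
(* [M] lies in the complement of [U k] by assumption and in [U k] by maximality, so it is orthogonal
   to itself. *)
apply: (@orth_self _ _ dot x M) => // y My; apply: sub; first exact: Mp.
by move: y My; apply: (unitary_part_max (T_adj k)) => // z Mz; have [] := MT z Mz.
Qed.

Lemma joint_part_largest theta :
  largest (fun L => joint_reducing dot T Q L /\
    forall k, has_type_on dot L (theta k) (T k)) (joint_part theta).
Proof.
split=> [|M [/joint_reducingP[Msub MT MT' _] Mtype] x Mx k].
  by split; [exact: joint_part_reducing|exact: joint_part_type].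
move: (Mtype k); case: (theta k) => /= [MU|[_ Mcnu]].
  by move: x Mx; apply: (unitary_part_max (T_adj k)); [exact: MT|exact: MT'|exact: MU].
apply: (orth_unitary_part_max dot_norm (T_adj k) Msub (MT k) (MT' k) _ Mx).
move=> N Nsub NM NT NT' NU; apply: contrapT => /eqP N0; apply: Mcnu.
by exists N; split => // z Nz; split; [exact: NT|exact: NT'].
Qed.

(** This is the commutation of the projections on [U k] and [U l]. It rests on [U l] and its
    complement being stable under [T k] and its adjoint. *)
Lemma part_split l k a x u v : part k a x -> U l u -> orth (U l) v -> x = u + v ->
  part k a u /\ part k a v.
Proof.
have Usub := unitary_part_subspace dot_norm (T l) (adjoint dot (T l)).
have Osub := orth_closed_subspace dot_norm (U l).
have OT := orth_stable (T_adj k) (@U_T' l k).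
have OT' := orth_stable (adjoint_pairC (T_adj k)) (@U_T l k).
move=> + Uu Ov xuv; case: a => /= kx.
  split.
    apply: (unitary_part_summand (T_adj k) Usub Osub _ _ OT OT' _ Uu Ov).
    - exact: U_T.
    - exact: U_T'.
    - by move=> p q Up Oq; apply/dotC0/Oq.
    - by rewrite -xuv.
  apply: (unitary_part_summand (T_adj k) Osub Usub OT OT' _ _ _ Ov Uu).
  - exact: U_T.
  - exact: U_T'.
  - by move=> p q Op; exact: Op.
  - by rewrite addrC -xuv.
have uO : orth (U k) u.
  (* Split [w] along [U l] as [w1 + w2]: both [x] and [v] are orthogonal to [w1], and [u] is
     orthogonal to [w2]. *)
  move=> w Uw.
  have [w1 [w2 [Uw1 kw1 Ow2 _ ->]]] :=
    unitary_part_split dot_norm (T_adj k) Usub (@U_T l k) (@U_T' l k) Uw.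
  have -> : u = x - v by rewrite xuv addrK.
  rewrite dotBl dotDr (kx _ kw1) add0r dotDr (Ov _ Uw1) add0r.
  by rewrite -dotBl xuv addrK (dotC0 (Ow2 _ Uu)).
split=> //; have -> : v = x - u by rewrite xuv addrC addKr.
exact: subspaceB (orth_closed_subspace dot_norm _) kx uO.
Qed.

Lemma joint_part_orth theta1 theta2 k x y : theta1 k <> theta2 k ->
  joint_part theta1 x -> joint_part theta2 y -> dot x y = 0.
Proof.
move=> + /(_ k) + /(_ k).
case: (theta1 k) (theta2 k) => [] [] //= _ h1 h2; [exact: dotC0 (h2 _ h1)|exact: h1].
Qed.

(* Induction on [m]: a vector constrained only from index [m.+1] on is split
   along [U m], which leaves the later constraints untouched. *)
Lemma joint_part_span (J : finType) (K : J -> set H) :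
    (forall j, closed_subspace (K j)) ->
    (forall theta, exists j, K j = joint_part theta) ->
  forall x, exists y : J -> H, (forall j, K j (y j)) /\ x = \sum_j y j.
Proof.
move=> Ksub Kparts.
suff span m : (m <= n)%N -> forall theta x,
    (forall k : 'I_n, (m <= k)%N -> part k (theta k) x) ->
    exists y : J -> H, (forall j, K j (y j)) /\ x = \sum_j y j.
  (* At [m = n] no index is constrained, so the constant [A_u] is a mere default. *)
  by move=> x; apply: (span n (leqnn n) (fun=> A_u)) => k; rewrite leqNgt ltn_ord.
elim: m => [_ theta x xth|m IH mn theta x xth].
  have [j Kj] := Kparts theta.
  exists (fun i => if i == j then x else 0); split=> [i|].
    by have [->|_] := eqVneq i j; [rewrite Kj => k; exact: xth|case: (Ksub i)].
  by rewrite -big_mkcond big_pred1_eq.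
pose k0 := Ordinal mn.
have Usub := unitary_part_subspace dot_norm (T k0) (adjoint dot (T k0)).
have [u Uu Ov] := proj_exists dot_norm Usub x.
have xuv : x = u + (x - u) by rewrite addrC subrK.
pose th a k := if k == k0 then a else theta k.
have later k : (m <= k)%N -> k != k0 -> (m < k)%N.
  by move=> mk kk0; rewrite ltn_neqAle mk andbT eq_sym; exact: kk0.
have [|yu [Kyu xu]] := IH (ltnW mn) (th A_u) u.
  move=> k mk; rewrite /th; have [->//|kk0] := eqVneq k k0.
  by have [] := part_split (xth k (later k mk kk0)) Uu Ov xuv.
have [|yv [Kyv xv]] := IH (ltnW mn) (th A_cnu) (x - u).
  move=> k mk; rewrite /th; have [->//|kk0] := eqVneq k k0.
  by have [] := part_split (xth k (later k mk kk0)) Uu Ov xuv.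
exists (fun j => yu j + yv j); split=> [j|]; first exact: subspaceD.
by rewrite big_split/= -xu -xv.
Qed.

End decomposition.

(** * Assembling the decomposition *)

Lemma largest_unique (V : Type) (P : set V -> Prop) (L : set V) :
  largest P L -> unique (largest P) L.
Proof.
move=> [PL Lmax]; split=> // M [PM Mmax].
by apply/seteqP; split; [exact: Mmax|exact: Lmax].
Qed.

Definition type_of_bool (b : bool) : op_type := if b then A_cnu else A_u.

Definition is_cnu (a : op_type) : bool := if a is A_cnu then true else false.

Lemma is_cnuK : cancel is_cnu type_of_bool.
Proof. by case. Qed.

Theorem theorem3p3 (R : realType) (H : completeNormedModType R[i])
    (dot : {dot H for Num.conj}) (dot_norm : hilbert_dot dot) (n : nat)
    (T : 'I_n -> {linear H -> H}) (Q : 'I_n -> 'I_n -> {linear H -> H})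
    (T_contr : forall i, contraction_on setT (T i))
    (TQ : doubly_Q_commuting dot T Q) :
  exists K : 'I_(2 ^ n) -> set H,
    [/\ (forall j, joint_reducing dot T Q (K j)) /\ orthogonal_sum dot K,
        (forall i j, unitary_on dot (K j) (T i) \/ cnu_on dot (K j) (T i)),
        largest (fun L => joint_reducing dot T Q L /\
                          forall k, unitary_on dot L (T k))
                (K (first_index n)),
        largest (fun L => joint_reducing dot T Q L /\
                          forall k, cnu_on dot L (T k))
                (K (last_index n))
      & exists t : ('I_n -> op_type) -> 'I_(2 ^ n),
          forall theta : 'I_n -> op_type,
            unique (largest (fun L => joint_reducing dot T Q L /\
                       forall k, has_type_on dot L (theta k) (T k)))
                   (K (t theta))].
Proof.
(* With [false] for unitary and [true] for c.n.u., the all-unitary pattern receives the first index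
   and the all-c.n.u. pattern the last. *)
have [f [[g fK gK] f0 f1]] := sign_pattern_index n.
pose theta_of j k := type_of_bool (g j k).
pose K j := joint_part dot T (theta_of j).
have theta_f (theta : 'I_n -> op_type) :
    theta_of (f [ffun k => is_cnu (theta k)]) = theta.
  by apply/funext => k; rewrite /theta_of fK ffunE is_cnuK.
have theta_first : theta_of (first_index n) = fun=> A_u.
  by apply/funext => k; rewrite /theta_of -f0 fK ffunE.
have theta_last : theta_of (last_index n) = fun=> A_cnu.
  by apply/funext => k; rewrite /theta_of -f1 fK ffunE.
exists K; split.
- split=> [j|]; first exact: joint_part_reducing.
  split=> [j l jl x y|].
    (* Distinct indices carry distinct patterns, which differ at some [k]; there one part lies in
       [U k] and the other in its complement. *)
    have [|k gjl] := (existsNP (fun k => g j k = g l k)).2.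
      by move=> gjl; move/negP: jl; apply; rewrite -(can_eq gK); apply/eqP/ffunP.
    apply: (joint_part_orth (k := k)) => /(congr1 is_cnu).
    by rewrite /theta_of; case: (g j k) (g l k) gjl => [] [].
  apply: (joint_part_span dot_norm T_contr TQ) => [j|theta].
    by case: (joint_part_reducing dot_norm T_contr TQ (theta_of j)).
  by exists (f [ffun k => is_cnu (theta k)]); rewrite /K theta_f.
- move=> i j; have := joint_part_type dot_norm T_contr (theta_of j) i.
  by case: (theta_of j i); [left|right].
- have := joint_part_largest dot_norm T_contr TQ (theta_of (first_index n)).
  by rewrite {1}theta_first.
- have := joint_part_largest dot_norm T_contr TQ (theta_of (last_index n)).
  by rewrite {1}theta_last.
- exists (fun theta => f [ffun k => is_cnu (theta k)]) => theta.
  by apply: largest_unique; rewrite /K theta_f; exact: joint_part_largest.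
Qed.
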